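(* Every tree is omnitonal.
   Context: Graphs are finite and simple; $e(G)=|E(G)|$. A $2$-coloring $E(K_n)=E(R)\cup E(B)$ is a partition of the edges of $K_n$ into red edges (forming $R$) and blue edges (forming $B$). An $(r,b)$-colored copy of $G$ (with $r+b=e(G)$) is a (not necessarily induced) subgraph of $K_n$ isomorphic to $G$ with exactly $r$ red and $b$ blue edges. ${\rm ot}(n,G)$ is the minimum non-negative integer $s$ such that every $2$-coloring $E(K_n)=E(R)\cup E(B)$ with $\min\{e(R),e(B)\}>s$ contains an $(r,b)$-colored copy of $G$ for every pair of integers $r,b\ge0$ with $r+b=e(G)$. The graph $G$ is omnitonal if for every sufficiently large $n$ such an integer exists non-vacuously, that is, ${\rm ot}(n,G)<\lfloor\frac12\binom n2\rfloor$ (so that there are colorings with $\min\{e(R),e(B)\}>{\rm ot}(n,G)$). *)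

(* Defs.v *)
From mathcomp Require Import all_boot.
From mathcomp Require Import boolp.

Set Implicit Arguments.
Unset Strict Implicit.
Unset Printing Implicit Defensive.

Record sgraph (V : finType) := SGraph {
  adj : rel V;
  adj_sym : symmetric adj;
  adj_irr : irreflexive adj
}.

Definition edges (V : finType) (G : sgraph V) : {set {set V}} :=
  [set [set x; y] | x in V, y in V & adj G x y].

Definition num_edges (V : finType) (G : sgraph V) : nat := #|edges G|.

Definition connected (V : finType) (G : sgraph V) : Prop :=
  0 < #|V| /\ forall x y : V, connect (adj G) x y.

(* The bound on the size excludes the empty sequence and a single edge traversed
   back and forth, which [ucycle] accepts. *)
Definition acyclic (V : finType) (G : sgraph V) : Prop :=
  forall c : seq V, 2 < size c -> ~ ucycle (adj G) c.

Definition is_tree (V : finType) (G : sgraph V) : Prop :=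
  connected G /\ acyclic G.

Lemma neq_sym (V : finType) : symmetric (fun x y : V => x != y).
Proof. by move=> x y; rewrite eq_sym. Qed.

Lemma neq_irr (V : finType) : irreflexive (fun x y : V => x != y).
Proof. by move=> x; rewrite eqxx. Qed.

Definition complete (n : nat) : sgraph 'I_n :=
  SGraph (@neq_sym 'I_n) (@neq_irr 'I_n).

Definition two_coloring (n : nat) (R B : sgraph 'I_n) : Prop :=
  edges R :|: edges B = edges (complete n) /\ edges R :&: edges B = set0.

(* The subgraph of K_n with vertex set W and edge set F is isomorphic to G. *)
Definition is_copy (V : finType) (G : sgraph V) (n : nat)
    (W : {set 'I_n}) (F : {set {set 'I_n}}) : Prop :=
  exists f : V -> 'I_n,
    [/\ injective f, W = [set f x | x : V]
      & F = [set f @: a | a : {set V} in edges G]].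

Definition has_colored_copy (V : finType) (G : sgraph V) (n : nat)
    (R B : sgraph 'I_n) (r b : nat) : Prop :=
  exists (W : {set 'I_n}) (F : {set {set 'I_n}}),
    [/\ is_copy G W F, #|F :&: edges R| = r & #|F :&: edges B| = b].

Definition ot_bound (V : finType) (G : sgraph V) (n s : nat) : Prop :=
  forall R B : sgraph 'I_n, two_coloring R B -> s < minn (num_edges R) (num_edges B) ->
  forall r b : nat, r + b = num_edges G -> has_colored_copy G R B r b.

(* Large values of s satisfy the condition vacuously. *)
Lemma ot_bound_exists (V : finType) (G : sgraph V) (n : nat) :
  exists s, `[< ot_bound G n s >].
Proof.
exists (num_edges (complete n)); apply/asboolP => R B [RB _].
by rewrite leq_min /num_edges ltnNge -RB subset_leq_card ?subsetUl.
Qed.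

Definition ot (n : nat) (V : finType) (G : sgraph V) : nat :=
  ex_minn (ot_bound_exists G n).

Definition omnitonal (V : finType) (G : sgraph V) : Prop :=
  exists N : nat, forall n : nat, N <= n -> ot n G < 'C(n, 2)./2.

(* Main.v *)
(* Let K = |V(G)|. In a balanced coloring of K_n, deleting vertices of degree
   less than K leaves a red core U and a blue core U', of minimum degree at
   least K in their colors; only O(Kn) edges are lost, so each core has more
   than 3n/5 vertices and I, the intersection of U and U', is large. Hence one
   color, say red, has a core inside I, which contains a red copy of any subtree
   of G with r edges. All vertices of this copy lie in U', so it extends greedily
   to a copy of G along blue edges. If the color is blue, start from a subtree
   with b edges and extend it in U along red edges. *)
Require Import Defs.
From mathcomp Require Import all_boot.
From mathcomp Require Import boolp zify.

Set Implicit Arguments.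
Unset Strict Implicit.
Unset Printing Implicit Defensive.

(** * Edges as two-element sets *)

Lemma mem_edges (V : finType) (G : sgraph V) (x y : V) :
  ([set x; y] \in edges G) = adj G x y.
Proof.
apply/imset2P/idP => [[a b _]|Gxy]; last by exists x y; rewrite ?inE.
rewrite inE => /andP[_ Gab] /setP E.
have nab : a != b by apply: contraTneq Gab => ->; rewrite adj_irr.
have /set2P[xa|xb] : x \in [set a; b] by rewrite -E set21.
  have := E b; rewrite xa set22 in_set2 eq_sym (negPf nab) /= => /eqP <-.
  by [].
have := E a; rewrite xb set21 in_set2 (negPf nab) /= => /eqP <-.
by rewrite adj_sym.
Qed.

Lemma edgesP (V : finType) (G : sgraph V) (a : {set V}) :
  reflect (exists x y, adj G x y /\ a = [set x; y]) (a \in edges G).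
Proof.
apply: (iffP idP) => [/imset2P[x y _]|[x [y [Gxy ->]]]]; last by rewrite mem_edges.
by rewrite inE => /andP[_ Gxy] ->; exists x, y.
Qed.

(** * Cores of large minimum degree *)

Section Cores.
Variables (W : finType) (G : sgraph W).

Definition degree_in (A : {set W}) (x : W) : nat := #|[set y in A | adj G x y]|.

(** Twice the number of edges induced on [A]. *)
Definition degree_sum (A : {set W}) : nat := \sum_(x in A) degree_in A x.

Definition min_degree_geq (K : nat) (A : {set W}) : Prop :=
  forall x, x \in A -> K <= degree_in A x.

Lemma degree_inE A x : degree_in A x = \sum_(y in A) adj G x y.
Proof.
rewrite /degree_in -sum1_card big_mkcond [RHS]big_mkcond.
by apply: eq_bigr => y _; rewrite inE; case: (y \in A) => //=; case: adj.
Qed.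

Lemma degree_sum_rem (A : {set W}) w : w \in A ->
  degree_sum A = degree_sum (A :\ w) + 2 * degree_in A w.
Proof.
move=> wA; rewrite /degree_sum (big_setD1 w) //=.
have D x : degree_in A x = adj G x w + degree_in (A :\ w) x.
  by rewrite !degree_inE (big_setD1 w).
rewrite (eq_bigr _ (fun x _ => D x)) big_split /= [in RHS]D adj_irr add0n D adj_irr.
suff -> : \sum_(i in A :\ w) adj G i w = degree_in (A :\ w) w by lia.
by rewrite degree_inE; apply: eq_bigr => y _; rewrite adj_sym.
Qed.

Lemma degree_sum_leq A : degree_sum A <= #|A| * #|A|.
Proof.
rewrite /degree_sum -sum_nat_const; apply: leq_sum => x _.
by apply: subset_leq_card; apply/subsetP => y; rewrite inE => /andP[yA _].
Qed.

(** Delete vertices of degree less than [K] one at a time: each of the at most [#|A|] deletions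
    lowers the degree sum by at most [2 * K]. The core [U] may be empty; the last bound serves to
    rule this out. *)
Lemma core_exists K (A : {set W}) : exists U : {set W},
  [/\ U \subset A, min_degree_geq K U & degree_sum A <= degree_sum U + 2 * K * #|A|].
Proof.
have [m leAm] := ubnP #|A|; elim: m => // m IHm in A leAm *.
have [/forall_inP coreA|] := boolP [forall x in A, K <= degree_in A x].
  by exists A; split=> //; lia.
rewrite negb_forall_in => /exists_inP[w wA]; rewrite -ltnNge => lt_w.
have cA := cardsD1 w A; rewrite wA in cA.
have [|U [UA coreU leU]] := IHm (A :\ w); first by lia.
exists U; split=> //; first exact: subset_trans UA (subD1set _ _).
by rewrite (degree_sum_rem wA); nia.
Qed.

Lemma handshake : 2 * num_edges G <= degree_sum [set: W].
Proof.
rewrite /degree_sum.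
have -> : \sum_(x in [set: W]) degree_in setT x
    = \sum_(p : W * W | adj G p.1 p.2) 1.
  rewrite -(pair_big_dep xpredT (fun x y => adj G x y) (fun _ _ => 1)) /=.
  apply: eq_big => [x|x _]; first by rewrite inE.
  by rewrite sum1_card; apply: eq_card => y; rewrite !inE.
rewrite (partition_big (fun p : W * W => [set p.1; p.2]) (mem (edges G))) /=; last first.
  by case=> x y /= Gxy; rewrite mem_edges.
rewrite mulnC /num_edges -sum_nat_const; apply: leq_sum => a /edgesP[x [y [Gxy ->]]].
have nxy : x != y by apply: contraTneq Gxy => ->; rewrite adj_irr.
(* The edge arises from both of its orientations. *)
rewrite sum1_card (_ : 2 = #|[set (x, y); (y, x)]|); last by rewrite cards2 xpair_eqE negb_and nxy.
apply: subset_leq_card; apply/subsetP => p /set2P[] ->.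
  by rewrite unfold_in /= Gxy eqxx.
by rewrite unfold_in /= adj_sym Gxy setUC eqxx.
Qed.

End Cores.

(** * Subtrees as vertex orderings *)

Section TreeOrder.
Variables (V : finType) (G : sgraph V).

(* The sequence lists the vertices of a subtree, the root last: each vertex but
   the root has exactly one neighbour (its parent) to its right. *)
Fixpoint tree_order (s : seq V) : bool :=
  if s is y :: s' then
    (s' == [::]) || [&& y \notin s', count (adj G y) s' == 1 & tree_order s']
  else true.

Lemma tree_order_catr t s : tree_order (t ++ s) -> tree_order s.
Proof.
elim: t => //= y t IHt /orP[|/and3P[_ _]] //.
by case: t {IHt} => //=; case: s.
Qed.

Lemma tree_order_uniq s : tree_order s -> uniq s.
Proof.
by elim: s => //= y s IHs /orP[/eqP->|/and3P[-> _ /IHs]].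
Qed.

Lemma count1P (p : pred V) s : count p s = 1 ->
  exists x, [/\ x \in s, p x & forall z, z \in s -> p z -> z = x].
Proof.
rewrite -size_filter; case E: (filter p s) => [|x [|]] //= _.
have H z : (p z && (z \in s)) = (z == x) by rewrite -mem_filter E inE.
have /andP[px xs] : p x && (x \in s) by rewrite H.
by exists x; split=> // z zs pz; apply/eqP; rewrite -H pz.
Qed.

Lemma tree_order_parent y s : tree_order (y :: s) -> s != [::] ->
  exists x, [/\ x \in s, adj G y x & forall z, z \in s -> adj G y z -> z = x].
Proof.
by move=> /= /orP[->//|/and3P[_ /eqP/count1P]].
Qed.

Definition edges_in (s : seq V) : {set {set V}} := [set a in edges G | a \subset s].

(** Every vertex but the root contributes exactly one new edge, the one to its parent. *)
Lemma card_edges_in s : tree_order s -> #|edges_in s| = (size s).-1.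
Proof.
elim: s => [|y s IHs] tys.
  apply: eq_card0 => a; rewrite !inE; apply/negP => /andP[/edgesP[x [y [_ ->]]]].
  by move=> /subsetP/(_ x); rewrite set21 => /(_ isT).
have ts : tree_order s := tree_order_catr (t := [:: y]) tys.
have [s0|sn0] := eqVneq s [::].
  subst s; apply: eq_card0 => a; rewrite !inE.
  apply/negP => /andP[/edgesP[u [v [uv ->]]]] /subsetP H.
  have := H u; have := H v; rewrite set21 set22 !inE => /(_ isT)/eqP vy /(_ isT)/eqP uy.
  by move: uv; rewrite uy vy adj_irr.
have /andP[ys _] := tree_order_uniq tys.
have [x [xs Gyx ux]] := tree_order_parent tys sn0.
have -> : edges_in (y :: s) = [set y; x] |: edges_in s.
  apply/setP => a; rewrite !inE; apply/andP/orP => [[aG /subsetP ays]|].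
    have [ya|ya] := boolP (y \in a); last first.
      right; rewrite aG; apply/subsetP => z za.
      have := ays z za; rewrite inE => /orP[/eqP zy|//].
      by rewrite -zy za in ya.
    left; case/edgesP: aG ya ays => u [v [uv ->]] ya H.
    have := H u; have := H v; rewrite set21 set22 !inE => /(_ isT) + /(_ isT).
    case/set2P: ya => E; rewrite -?E in uv *.
      case/predU1P => [vy|vs]; first by rewrite vy adj_irr in uv.
      by rewrite (ux v).
    move=> _ /predU1P[uy|us]; first by rewrite uy adj_irr in uv.
    by rewrite adj_sym in uv; rewrite setUC (ux u).
  case=> [/eqP->|/andP[-> /subsetP H]].
    rewrite mem_edges Gyx; split=> //; apply/subsetP => z /set2P[->|->]; rewrite inE ?eqxx //.
    by rewrite xs orbT.
  by split=> //; apply/subsetP => z /H zs; rewrite inE zs orbT.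
rewrite cardsU1 IHs // !inE mem_edges Gyx /=.
have -> /= : ~~ ([set y; x] \subset s).
  by apply/negP => /subsetP/(_ y); rewrite set21 (negPf ys) => /(_ isT).
by case: s sn0 {IHs tys ts ys xs ux}.
Qed.

(** Parents link every vertex to the root. The relation keeps paths inside [s], so that a vertex
    outside [s] can close them into cycles. *)
Lemma tree_order_connect s : tree_order s ->
  {in s &, forall x y, connect [rel a b | adj G a b && (b \in s)] x y}.
Proof.
elim: s => [|y s IHs] // tys.
have ts : tree_order s := tree_order_catr (t := [:: y]) tys.
have [->|sn0] := eqVneq s [::].
  by move=> a b; rewrite !inE => /eqP-> /eqP->; exact: connect0.
have [x [xs Gyx _]] := tree_order_parent tys sn0.
have sub a b : a \in s -> b \in s ->
    connect [rel a b | adj G a b && (b \in y :: s)] a b.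
  move=> as_ bs; apply: connect_sub (IHs ts _ _ as_ bs) => u v /= /andP[uv vs].
  by apply: connect1; rewrite /= uv inE vs orbT.
have yx : connect [rel a b | adj G a b && (b \in y :: s)] y x.
  by apply: connect1; rewrite /= Gyx inE xs orbT.
have xy : connect [rel a b | adj G a b && (b \in y :: s)] x y.
  by apply: connect1; rewrite /= adj_sym Gyx inE eqxx.
move=> a b /predU1P[->|as_] /predU1P[->|bs]; first exact: connect0.
- exact: connect_trans yx (sub _ _ xs bs).
- exact: connect_trans (sub _ _ as_ xs) xy.
- exact: sub.
Qed.

(** Connectedness yields a vertex [y] outside [s] with a neighbour in [s]; a second such neighbour
    would create a cycle. *)
Lemma tree_order_extend s z : is_tree G -> tree_order s -> s != [::] -> z \notin s ->
  exists y, tree_order (y :: s).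
Proof.
move=> [[_ conn] acyc] ts sn0 zs.
have [x0 x0s] : exists x, x \in s.
  by case: s sn0 {ts zs} => // x s _; exists x; rewrite inE eqxx.
have [x [y [xs ys Gxy]]] : exists x y, [/\ x \in s, y \notin s & adj G x y].
  apply: contrapT => no.
  (* With no edge leaving [s], the vertex [z] could not be reached from [x0]. *)
  have cl : closed (adj G) (mem s).
    move=> a b ab /=; apply/idP/idP => H; apply: contrapT => /negP nH; apply: no.
      by exists a, b.
    by exists b, a; split=> //; rewrite adj_sym.
  by have := closed_connect cl (conn x0 z); rewrite /= x0s (negPf zs).
exists y; rewrite /= (negPf sn0) ys ts andbT /=.
have us := tree_order_uniq ts.
have cpos : 0 < count (adj G y) s by rewrite -has_count; apply/hasP; exists x; rewrite // adj_sym.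
rewrite eqn_leq cpos andbT leqNgt -size_filter; apply/negP => c2.
have := filter_uniq (adj G y) us.
case E: (filter _ _) c2 => [|a [|b l]] //= _; rewrite inE negb_or => /andP[/andP[nab _] _].
have /andP[Gya as_] : adj G y a && (a \in s) by rewrite -mem_filter E inE eqxx.
have /andP[Gyb bs] : adj G y b && (b \in s) by rewrite -mem_filter E !inE eqxx orbT.
have /connectP[p0 path_p0 last_p0] := tree_order_connect ts as_ bs.
(* A simple path from [a] to [b] inside [s] closes up through [y]; since [a] differs from [b], the
   cycle has at least three vertices. *)
case/shortenP: path_p0 last_p0 => p path_p uniq_p _ last_p.
have p_in : {subset p <= s}.
  elim: (p) (a) path_p => //= u q IHq v /andP[/andP[_ us'] /IHq H] w.
  by rewrite inE => /predU1P[->|/H].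
apply: (acyc (y :: a :: p)).
  by case: (p) last_p nab => //= ->; rewrite eqxx.
rewrite /ucycle; apply/andP; split; last first.
  rewrite cons_uniq uniq_p andbT inE negb_or; apply/andP; split.
    by apply: contraNneq ys => ->.
  by apply: contra ys => /p_in.
rewrite /= Gya rcons_path -last_p adj_sym Gyb andbT /=.
by apply: sub_path path_p => u v /= /andP[].
Qed.

Lemma tree_order_full : is_tree G -> exists s, tree_order s /\ forall x, x \in s.
Proof.
move=> tG; have [v0 _] : exists v : V, v \in V by have [[/card_gt0P]] := tG.
have H m : m < #|V| -> exists2 s, tree_order s & size s = m.+1.
  elim: m => [|m IHm] lt; first by exists [:: v0].
  have [|s ts sz] := IHm; first by lia.
  have [z zs] : exists z, z \notin s.
    apply: contrapT => no; have: #|V| <= #|s|.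
      by apply: subset_leq_card; apply/subsetP => z _; apply: contrapT => /negP zs; apply: no; exists z.
    by have := card_size s; lia.
  have [|y tys] := @tree_order_extend s z tG ts _ zs; first by case: (s) sz.
  by exists (y :: s); rewrite //= sz.
have V0 : 0 < #|V| by apply/card_gt0P; exists v0.
have [|s ts sz] := H #|V|.-1; first by lia.
exists s; split=> // x; have /card_uniqP cs := tree_order_uniq ts.
have eq_s : #|s| = #|V| by rewrite cs sz prednK.
by rewrite (subset_cardP eq_s (subset_predT _)).
Qed.

(** * Greedy embedding into cores *)

Section Embedding.
Variables (W : finType) (H : sgraph W) (D : {set W}).
Hypothesis degD : min_degree_geq H #|V| D.

Lemma embed_extend t s (f : V -> W) :
  tree_order (t ++ s) -> s != [::] -> {in s &, injective f} ->
  {in s, forall x, f x \in D} ->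
  exists g : V -> W, [/\ {in s, g =1 f}, {in t ++ s &, injective g},
    {in t ++ s, forall x, g x \in D}
    & {in t ++ s &, forall x y, adj G x y -> ~~ ((x \in s) && (y \in s)) ->
         adj H (g x) (g y)}].
Proof.
move=> + sn0 injf fD; elim: t => [|y t IHt] ty.
  by exists f; split=> //= x y xs ys _; rewrite xs ys.
have tt : tree_order (t ++ s) := tree_order_catr (t := [:: y]) ty.
have [g [gf ginj gD gadj]] := IHt tt.
have tsn0 : t ++ s != [::] by case: (t) (s) sn0 => [|? ?] [].
have [x [xs Gyx ux]] := tree_order_parent ty tsn0.
have yts : y \notin t ++ s by have /andP[] := tree_order_uniq ty.
have [w [wD Hxw wnew]] : exists w, [/\ w \in D, adj H (g x) w & w \notin map g (t ++ s)].
  (* Strict because [y] is not yet placed; the parent's image has at least [#|V|] neighbours in [D],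
     so one is free. *)
  have lt : #|map g (t ++ s)| < #|V|.
    apply: leq_ltn_trans (card_size _) _; rewrite size_map.
    have /card_uniqP /= <- := tree_order_uniq ty.
    exact: max_card.
  have := leq_trans lt (degD (gD _ xs)); rewrite ltnNge => /negP le.
  apply: contrapT => no; apply: le; apply: subset_leq_card; apply/subsetP => w.
  rewrite inE => /andP[wD Hw]; apply: contrapT => /negP nw; apply: no; by exists w.
pose h v := if v == y then w else g v.
have hy : h y = w by rewrite /h eqxx.
have hg v : v \in t ++ s -> h v = g v.
  by move=> vts; rewrite /h ifN //; apply: contraNneq yts => <-.
have ney v : v \in t ++ s -> w != g v.
  by move=> vts; apply: contraNneq wnew => ->; apply: map_f.
exists h; split.
- by move=> v vs; rewrite hg ?gf // mem_cat vs orbT.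
- move=> a b /predU1P[->|ats] /predU1P[->|bts] //; rewrite ?hy ?hg //.
  + by move/eqP; rewrite (negPf (ney _ bts)).
  + by move/esym/eqP; rewrite (negPf (ney _ ats)).
  + exact: ginj.
- by move=> a /predU1P[->|ats]; rewrite ?hy ?hg // gD.
- move=> a b /predU1P[->|ats] /predU1P[->|bts]; rewrite ?adj_irr // ?hy ?hg //.
  + by move=> /(ux b bts) -> _; rewrite adj_sym.
  + by rewrite adj_sym => /(ux a ats) -> _.
  + exact: gadj.
Qed.

End Embedding.

(* A prefix of the tree is embedded along [P] inside [D1], and the rest is then
   attached along [Q] inside the larger core [D2]. *)
Lemma two_core_embedding (W : finType) (P Q : sgraph W) (D1 D2 : {set W}) (p : nat) :
  is_tree G -> p <= num_edges G -> D1 != set0 -> D1 \subset D2 ->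
  min_degree_geq P #|V| D1 -> min_degree_geq Q #|V| D2 ->
  exists (f : V -> W) (E : {set {set V}}),
    [/\ injective f, E \subset edges G, #|E| = p,
        {in E, forall a : {set V}, f @: a \in edges P}
      & {in edges G :\: E, forall a : {set V}, f @: a \in edges Q}].
Proof.
move=> tG pG /set0Pn[w0 w0D] /subsetP D12 deg1 deg2.
have [s [ts sV]] := tree_order_full tG.
have Es : edges_in s = edges G.
  by apply/setP => a; rewrite inE; case: (a \in _) => //=; apply/subsetP.
have szs : num_edges G = (size s).-1 by rewrite -card_edges_in // Es.
have sgt0 : 0 < size s.
  by have [[/card_gt0P[v _] _] _] := tG; move: (sV v); case: (s).
(* Parents lie to the right, so a suffix of [p.+1] vertices is a subtree with [p] edges. *)
pose t2 := take (size s - p.+1) s; pose s1 := drop (size s - p.+1) s.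
have def_s : s = t2 ++ s1 by rewrite cat_take_drop.
have sz1 : size s1 = p.+1 by rewrite size_drop; lia.
have ts1 : tree_order s1 by apply: (@tree_order_catr t2); rewrite -def_s.
case/lastP E1: s1 (sz1) => [|t1 v0] // _; rewrite -cats1 in E1.
have ts1' := ts1; rewrite E1 in ts1'.
(* The root alone goes to [w0]; a constant map is injective on one vertex. *)
have [||f [_ finj fD fadj]] := embed_extend deg1 (f := fun _ => w0) ts1' isT.
- by move=> a b; rewrite !inE => /eqP-> /eqP->.
- by [].
rewrite -E1 in finj fD fadj.
have [||||g [gf ginj gD gadj]] := @embed_extend _ Q D2 deg2 t2 s1 f; rewrite -?def_s //.
- by rewrite E1; case: (t1).
- by move=> x /fD/D12.
rewrite -def_s in ginj gadj.
exists g, (edges_in s1); split.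
- by move=> x y; apply: ginj; apply: sV.
- by apply/subsetP => a; rewrite inE => /andP[].
- by rewrite card_edges_in // sz1.
- move=> a; rewrite inE => /andP[/edgesP[x [y [xy ->]]] /subsetP H].
  have xs1 : x \in s1 by apply: H; rewrite set21.
  have ys1 : y \in s1 by apply: H; rewrite set22.
  rewrite imsetU !imset_set1 mem_edges !gf //; apply: fadj => //.
  rewrite !inE; apply: contraTN xy => /andP[/eqP-> /eqP->].
  by rewrite adj_irr.
- move=> a; rewrite !inE => /andP[+ aG]; rewrite aG /=.
  case/edgesP: aG => x [y [xy ->]] nsub.
  rewrite imsetU !imset_set1 mem_edges; apply: gadj => //.
  apply: contra nsub => /andP[xs ys]; apply/subsetP => z.
  by case/set2P=> ->.
Qed.

End TreeOrder.

(** * Colored copies in balanced colorings *)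

Lemma two_coloringC n (R B : sgraph 'I_n) : two_coloring R B -> two_coloring B R.
Proof. by case=> c d; split; rewrite ?[edges B :|: _]setUC // setIC. Qed.

Lemma has_colored_copyC (V : finType) (G : sgraph V) n (R B : sgraph 'I_n) r b :
  has_colored_copy G R B r b -> has_colored_copy G B R b r.
Proof. by case=> W [F [cp cR cB]]; exists W, F. Qed.

(** As the colors are disjoint, the edges of the copy in [P] are exactly the images of [E], so both
    counts are exact. *)
Lemma two_core_copy (V : finType) (G : sgraph V) n (P Q : sgraph 'I_n)
    (D1 D2 : {set 'I_n}) (p q : nat) :
  is_tree G -> two_coloring P Q -> p + q = num_edges G ->
  D1 != set0 -> D1 \subset D2 ->
  min_degree_geq P #|V| D1 -> min_degree_geq Q #|V| D2 ->
  has_colored_copy G P Q p q.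
Proof.
move=> tG [_ dis] pq D1n0 D12 deg1 deg2.
have [|f [E [injf EG cE EP EQ]]] := two_core_embedding (p := p) tG _ D1n0 D12 deg1 deg2.
  by lia.
have PQ a : a \in edges P -> a \in edges Q -> False.
  by move=> aP aQ; have := in_set0 a; rewrite -dis inE aP aQ.
have injF : injective (fun a : {set V} => f @: a) by apply: imset_inj.
exists [set f x | x : V], [set f @: a | a : {set V} in edges G]; split.
- by exists f.
- rewrite -cE -(card_imset (mem E) injF); apply: eq_card => c; rewrite inE.
  apply/andP/imsetP => [[/imsetP[a aG ->] aP]|[a aE ->]].
    exists a => //; apply: contrapT => /negP nE; apply: (PQ _ aP).
    by apply: EQ; rewrite inE nE.
  by rewrite EP //; split=> //; apply: imset_f; apply: (subsetP EG).
- have <- : #|edges G :\: E| = q.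
    by rewrite cardsD (setIidPr EG) cE -/(num_edges G); lia.
  rewrite -(card_imset (mem (edges G :\: E)) injF); apply: eq_card => c; rewrite inE.
  apply/andP/imsetP => [[/imsetP[a aG ->] aQ]|[a aE ->]].
    exists a => //; rewrite inE aG andbT; apply/negP => aE; exact: (PQ _ (EP _ aE) aQ).
  by rewrite EQ //; split=> //; apply: imset_f; move: aE; rewrite inE => /andP[].
Qed.

Lemma two_coloring_degree_sum n (R B : sgraph 'I_n) (A : {set 'I_n}) :
  two_coloring R B -> #|A| * #|A|.-1 <= degree_sum R A + degree_sum B A.
Proof.
move=> [cov _]; rewrite /degree_sum -big_split /= -sum_nat_const; apply: leq_sum => x xA.
have -> : #|A|.-1 = #|A :\ x| by rewrite (cardsD1 x A) xA.
apply: leq_trans (leq_card_setU _ _); apply: subset_leq_card; apply/subsetP => y.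
rewrite !inE => /andP[yx yA]; rewrite yA /= -!mem_edges -in_setU cov mem_edges /=.
by rewrite eq_sym.
Qed.

(** The degree sum of the core is at least about [n * n / 2 - 2 * K * n], whereas a core with fewer
    than [3 * n / 5] vertices allows at most [9 * n * n / 25]. *)
Lemma large_core n K (R : sgraph 'I_n) : 100 * K.+1 <= n -> 'C(n, 2)./2 <= num_edges R ->
  exists2 U : {set 'I_n}, min_degree_geq R K U & 3 * n <= 5 * #|U|.
Proof.
move=> nK eR; have [U [_ degU leU]] := core_exists R K [set: 'I_n].
exists U => //; have := handshake R; have := degree_sum_leq R U.
rewrite cardsT card_ord in leU; have := bin2 n.
have -> : n * n.-1 = n * n - n by nia.
have Kn : 100 * (K * n) + 100 * n <= n * n by nia.
rewrite leqNgt => binE Ule hand; apply/negP => small.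
have sq : 25 * (#|U| * #|U|) <= 9 * (n * n) by nia.
by rewrite -mulnA in leU; lia.
Qed.

Lemma balanced_copy (V : finType) (G : sgraph V) n (R B : sgraph 'I_n) r b :
  is_tree G -> 100 * #|V|.+1 <= n -> two_coloring R B ->
  'C(n, 2)./2 <= num_edges R -> 'C(n, 2)./2 <= num_edges B ->
  r + b = num_edges G -> has_colored_copy G R B r b.
Proof.
move=> tG nV col eR eB rb.
have [U degU cU] := large_core nV eR.
have [U' degU' cU'] := large_core nV eB.
pose I := U :&: U'.
(* The two sizes add up to at least [6 * n / 5], and the union has at most [n] vertices. *)
have cI : n <= 5 * #|I|.
  have := cardsUI U U'; have := subset_leq_card (subsetT (U :|: U')).
  by rewrite cardsT card_ord -/I; lia.
have [D [DI degD leD]] := core_exists R #|V| I.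
have [D' [DI' degD' leD']] := core_exists B #|V| I.
have [D0|Dn0] := eqVneq D set0; last first.
  by apply: (two_core_copy tG col rb Dn0 _ degD degU'); apply: subset_trans DI (subsetIr _ _).
have [D'0|D'n0] := eqVneq D' set0; last first.
  apply: has_colored_copyC; rewrite addnC in rb.
  apply: (two_core_copy tG (two_coloringC col) rb D'n0 _ degD' degU).
  exact: subset_trans DI' (subsetIl _ _).
(* If both cores inside [I] were empty, then [#|I| * #|I|.-1] would be at most [4 * #|V| * #|I|],
   contradicting [#|I| >= 20 * #|V|.+1]. *)
have := two_coloring_degree_sum I col.
move: leD leD'; rewrite D0 D'0 /degree_sum !big_set0; nia.
Qed.

Theorem theorem2p10 (V : finType) (G : sgraph V) (hG : is_tree G) :
  omnitonal G.
Proof.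
exists (100 * #|V|.+1) => n nV.
have Cpos : 0 < 'C(n, 2)./2 by have := bin2 n; nia.
rewrite /ot; case: ex_minnP => m _ min_m.
(* Exceeding this value means that each color has at least ['C(n, 2)./2] edges; [Cpos] makes the
   predecessor strictly smaller. *)
suff /asboolP/min_m : ot_bound G n ('C(n, 2)./2).-1 by lia.
move=> R B col; rewrite leq_min => /andP[eR eB] r b rb.
by apply: balanced_copy => //; lia.
Qed.
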